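(* Let $n\geq 8$ be an integer, and for $k\in\mathbb{N}$ with $1\le k\le [\frac{n}{2}]-1$ let $\Gamma=Cay(\mathbb{Z}_n,S_k)$ be the Cayley graph on the cyclic group $\mathbb{Z}_n$, where $S_1=\{1,n-1\}$, ..., $S_k=S_{k-1}\cup\{k,n-k\}$ are inverse closed subsets of $\mathbb{Z}_n-\{0\}$. If $n$ is an even integer and $k=\frac{n}{2}-1$, then the minimum cardinality of a doubly resolving set of $\Gamma$ is $k+1$.
   Context: $[x]$ denotes the integer part of $x$. For a finite group $G$ and a subset $\Omega\subseteq G$ closed under inverses and not containing the identity, the Cayley graph $Cay(G,\Omega)$ has vertex set $G$ and edge set $\{\{x,y\} : x^{-1}y\in\Omega\}$ (for the additive group $\mathbb{Z}_n$, $x^{-1}y$ means $y-x$). For a finite connected graph $\Gamma$ of order at least $2$ with graph distance $d$, vertices $x,y$ doubly resolve vertices $u,v$ if $d(u,x)-d(u,y)\neq d(v,x)-d(v,y)$. A set $Z$ of vertices is a doubly resolving set of $\Gamma$ if every two distinct vertices of $\Gamma$ are doubly resolved by some two vertices of $Z$. The minimum cardinality of a doubly resolving set is denoted $\psi(\Gamma)$. *)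

(* Defs.v *)
From mathcomp Require Import all_boot all_order all_algebra all_fingroup.
Set Implicit Arguments. Unset Strict Implicit. Unset Printing Implicit Defensive.
Import GRing.Theory.

(* A finite simple graph is its adjacency relation on a finType. *)

(* The edges {x, y} with x^-1 * y \in Omega: for Omega closed under inverses
   this relation is symmetric, and for 1 \notin Omega it is irreflexive. *)
Definition cayley (gT : finGroupType) (Omega : {set gT}) : rel gT :=
  fun x y => (x^-1 * y)%g \in Omega.

Section Resolving.
Variables (T : finType) (e : rel T).

Definition has_walk (x y : T) (m : nat) : bool :=
  [exists p : m.-tuple T, path e x p && (last x p == y)].

(* Connected vertices are at distance less than #|T|, so the search bound only
   matters for disconnected vertices, which get the junk value #|T|. *)
Definition gdist (x y : T) : nat := find (has_walk x y) (iota 0 #|T|).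

Definition doubly_resolve (x y u v : T) : bool :=
  ((gdist u x)%:Z - (gdist u y)%:Z != (gdist v x)%:Z - (gdist v y)%:Z)%R.

Definition doubly_resolving_set (Z : {set T}) : bool :=
  [forall u, forall v, (u != v) ==>
    [exists x in Z, exists y in Z, doubly_resolve x y u v]].

(* In a connected graph setT is doubly resolving (u and v doubly resolve
   themselves), so this is a genuine minimum. *)
Definition psi : nat :=
  #|[arg min_(Z < [set: T] | doubly_resolving_set Z) #|Z|]|.

End Resolving.

(* The union of the {i, n - i} for 1 <= i <= k; S_1 = {1, n-1}. *)
Fixpoint circ_set (n k : nat) : {set 'Z_n} :=
  if k is k'.+1 then circ_set n k' :|: [set k%:R; (n - k)%:R]%R
  else set0.

(* Main.v *)
(* The graph is the cocktail party graph: [k = n/2 - 1] makes every vertex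
   adjacent to all others except its antipode at distance [n/2]. So two
   antipodes are separated only by themselves, and a doubly resolving set must
   meet each of the [n/2] antipodal pairs. Conversely, take one vertex from each
   pair. Given [u <> v], let [x] be the chosen vertex of the pair of [u] and [y]
   a chosen vertex from neither pair: [y] is at distance 1 from both [u] and
   [v], while [x] is at different distances from them, so [x] and [y] doubly
   resolve [u] and [v]. *)
Require Import Defs.
From mathcomp Require Import all_boot all_order all_algebra all_fingroup.
From mathcomp Require Import zify.

Section Distance.
Variables (T : finType) (e : rel T).

Lemma has_walk0 x y : has_walk e x y 0 = (x == y).
Proof.
apply/existsP/idP => [[p]|xy]; first by rewrite tuple0.
by exists [tuple].
Qed.

Lemma has_walk1 x y : has_walk e x y 1 = e x y.
Proof.
apply/existsP/idP => [[[[|a []] //= _]]|exy].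
  by rewrite andbT => /andP[exa /eqP <-].
by exists [tuple y]; rewrite /= exy eqxx.
Qed.

Lemma has_walk2 x z y : e x z -> e z y -> has_walk e x y 2.
Proof. by move=> exz ezy; apply/existsP; exists [tuple z; y]; rewrite /= exz ezy eqxx. Qed.

Lemma gdist_le2 x y : 2 < #|T| -> (e x y) || [exists z, e x z && e z y] ->
  gdist e x y = if x == y then 0 else if e x y then 1 else 2.
Proof.
(* With three vertices or more, the search list of [gdist] starts with 0, 1, 2, so [find] can be
   unfolded on these entries. *)
rewrite /gdist; case: #|T| => [|[|[|q]]] //= _ exy.
rewrite has_walk0 has_walk1; case: eqP => // _.
case: ifP exy => //= _ /existsP[z /andP[exz ezy]].
by rewrite (has_walk2 _ _ _ exz ezy).
Qed.

Lemma doubly_resolving_setS (Z Z' : {set T}) : Z \subset Z' ->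
  doubly_resolving_set e Z -> doubly_resolving_set e Z'.
Proof.
move=> /subsetP ZZ' /forallP dZ; apply/forallP => u; apply/forallP => v.
apply/implyP => uv; have /forallP/(_ v)/implyP/(_ uv) := dZ u.
case/exists_inP => x /ZZ' xZ /exists_inP[y /ZZ' yZ r].
by apply/exists_inP; exists x => //; apply/exists_inP; exists y.
Qed.

Lemma psi_eq (Z : {set T}) : doubly_resolving_set e Z ->
  (forall Z', doubly_resolving_set e Z' -> #|Z| <= #|Z'|) -> psi e = #|Z|.
Proof.
move=> dZ minZ; rewrite /psi.
case: arg_minnP => [|Z' dZ' minZ'].
  exact: doubly_resolving_setS (subsetT Z) dZ.
by apply/eqP; rewrite eqn_leq minZ' // minZ.
Qed.

End Distance.

Section CocktailParty.
Variables (T : finType) (e : rel T) (f : T -> T) (A : {set T}).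
Hypothesis fK : involutive f.
(** This makes [f] free of fixed points and [A] a transversal of the pairs [{x, f x}]; [rep x] below
    is the element of [A] in the pair of [x]. *)
Hypothesis fA : forall x, (f x \in A) = (x \notin A).
Hypothesis eE : forall x y, e x y = (x != y) && (y != f x).
Hypothesis A_gt2 : 2 < #|A|.

Let rep x := if x \in A then x else f x.

Let rep_in x : rep x \in A.
Proof. by rewrite /rep; case: ifP => // xA; rewrite fA xA. Qed.

Let third_point a b : exists2 y, y \in A & (y != a) && (y != b).
Proof.
have : 0 < #|A :\: [set a; b]|.
  rewrite cardsD subn_gt0; apply: leq_trans A_gt2.
  rewrite ltnS; apply: leq_trans (subset_leq_card (subsetIr _ _)) _.
  by rewrite cards2; case: eqP.
rewrite card_gt0 => /set0Pn[y]; rewrite !inE negb_or => /andP[ab yA].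
by exists y.
Qed.

Let neq_f x : x != f x.
Proof. by apply/eqP => xf; have := fA x; rewrite -xf; case: (x \in A). Qed.

Lemma gdist_cocktail x y :
  gdist e x y = if x == y then 0 else if y == f x then 2 else 1.
Proof.
rewrite gdist_le2; last 1 first.
(* A point of [A] outside the pairs of [x] and [y] is a common neighbour of both. *)
- have [z zA /andP[zx zy]] := third_point (rep x) (rep y).
  apply/orP; right; apply/existsP; exists z.
  have ne w : z != rep w -> (z != w) && (z != f w).
    rewrite /rep; case: ifPn => wA zw; rewrite zw ?andbT //=.
      by apply: contraTneq zA => ->; rewrite fA wA.
    by apply: contraNneq wA => <-.
  case/andP: (ne _ zx) => zx1 zx2; case/andP: (ne _ zy) => zy1 zy2.
  by rewrite !eE zx2 zy1 [x == z]eq_sym zx1 /= -(inj_eq (inv_inj fK)) fK eq_sym.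
- by rewrite eE; case: eqP => //= _; case: eqP.
- exact: leq_trans A_gt2 (max_card _).
Qed.

(** Inside [A], only [rep u] can differ from distance 1 to [u]: it is [u] itself or its antipode. *)
Let gdist_rep u x : x \in A ->
  gdist e u x = if x == rep u then (if u \in A then 0 else 2) else 1.
Proof.
move=> xA; rewrite gdist_cocktail /rep; have [uA|uA] := boolP (u \in A).
  rewrite eq_sym; case: ifP => // _; case: ifP => // /eqP xf.
  by move: xA; rewrite xf fA uA.
by rewrite (negbTE (_ : u != x)) //; apply: contraNneq uA => ->.
Qed.

Let rep_inj u v : rep u = rep v -> (u \in A) = (v \in A) -> u = v.
Proof.
move=> + uvA; rewrite /rep uvA; case: ifP => // _; exact: inv_inj fK _ _.
Qed.

Lemma transversal_doubly_resolving : doubly_resolving_set e A.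
Proof.
apply/forallP => u; apply/forallP => v; apply/implyP => uv.
have [y yA /andP[/negbTE yu /negbTE yv]] := third_point (rep u) (rep v).
apply/exists_inP; exists (rep u) => //; apply/exists_inP; exists y => //.
rewrite /doubly_resolve !gdist_rep // yu yv eqxx.
(* In distinct pairs, [rep u] is at distance 0 or 2 from [u] but 1 from [v]. In a common pair, one
   of [u], [v] lies in [A], and the distances are 0 and 2. *)
have [ruv|_] := eqVneq (rep u) (rep v); last by case: (u \in A).
have : (u \in A) != (v \in A).
  by apply: contra uv => /eqP uvA; apply/eqP/rep_inj.
by case: (u \in A); case: (v \in A).
Qed.

Lemma leq_doubly_resolving Z : doubly_resolving_set e Z -> #|A| <= #|Z|.
Proof.
move=> /forallP dZ.
(* Meeting every pair means that [rep] maps [Z] onto a superset of [A]. *)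
suff /subset_leq_card/leq_trans : A \subset rep @: Z by apply; exact: leq_imset_card.
apply/subsetP => a aA; apply/imsetP.
have [aZ|aNZ] := boolP (a \in Z); first by exists a; rewrite // /rep aA.
have [fZ|fNZ] := boolP (f a \in Z).
  by exists (f a); rewrite // /rep fA aA fK.
have /forallP/(_ (f a))/implyP/(_ (neq_f a)) := dZ a.
case/exists_inP => x xZ /exists_inP[y yZ]; rewrite /doubly_resolve.
(* If [Z] misses the pair of [a], all its points are at distance 1 from both [a] and [f a], which
   are then not doubly resolved. *)
have d1 w : w \in Z -> (gdist e a w = 1) * (gdist e (f a) w = 1).
  move=> wZ; rewrite !gdist_cocktail fK ![_ == w]eq_sym.
  have /negbTE-> : w != a by apply: contraTneq wZ => ->.
  by have /negbTE-> : w != f a by apply: contraTneq wZ => ->.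
by rewrite !d1 // eqxx.
Qed.

Lemma psi_cocktail : psi e = #|A|.
Proof. exact: psi_eq transversal_doubly_resolving leq_doubly_resolving. Qed.

End CocktailParty.

Lemma val_ZpD n (x y : 'Z_n) : 1 < n -> (x + y)%R = (x + y) %% n :> nat.
(* The modulus of ['Z_n] is [(Zp_trunc n).+2], equal to [n] only when [1 < n]; the pattern rewrites
   the explicit modulus and leaves the types alone. *)
Proof. by move=> n1; rewrite -[X in _ = _ %% X](Zp_cast n1). Qed.

Lemma val_ZpN n (x : 'Z_n) : 1 < n -> (- x)%R = (n - x) %% n :> nat.
Proof. by move=> n1; rewrite -[X in _ = (X - _) %% X](Zp_cast n1). Qed.

(** Each induction step extends the intervals [[1, k]] and [[n - k, n - 1]] by one point. *)
Lemma mem_circ_set n k (z : 'Z_n) : 1 < n -> k < n ->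
  (z \in circ_set n k) = (0 < z) && ((z <= k) || (n - k <= z)).
Proof.
move=> n1; have zn : z < n by rewrite -[ltnRHS](Zp_cast n1).
elim: k => [|k IHk] kn; first by rewrite inE; lia.
have -> : (z \in circ_set n k.+1) = [|| z \in circ_set n k,
    z == (k.+1%:R : 'Z_n)%R :> nat | z == ((n - k.+1)%:R : 'Z_n)%R :> nat].
  by rewrite !inE.
by rewrite (IHk (ltnW kn)) !val_Zp_nat // !modn_small; lia.
Qed.

Lemma card_Zp_lt n m : 1 < n -> m <= n -> #|[set x : 'Z_n | x < m]| = m.
Proof.
move=> n1 mn; have mn' : m <= (Zp_trunc n).+2 by rewrite Zp_cast.
have -> : [set x : 'Z_n | x < m] = widen_ord mn' @: [set: 'I_m].
  apply/setP => x; rewrite inE; apply/idP/imsetP => [xm|[i _ ->]] //=.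
  by exists (Ordinal xm); rewrite ?inE //; apply: val_inj.
by rewrite card_imset ?cardsT ?card_ord // => i j [/val_inj].
Qed.

Theorem theorem3p6 (n k : nat) (hn : 8 <= n) (hk1 : 1 <= k)
  (hk2 : k <= n %/ 2 - 1) (hev : ~~ odd n) (hk : k = n %/ 2 - 1) :
  psi (cayley (circ_set n k)) = k + 1.
Proof.
have n1 : 1 < n by lia.
have nE : n = (k + 1) + (k + 1) by lia.
(* Here [m] is [n / 2] and [f] is the antipodal map; the residues below [m] will form the
   transversal. *)
pose m := k + 1; pose f (x : 'Z_n) := (x + m%:R)%R.
have ltZ (x : 'Z_n) : x < n by rewrite -[ltnRHS](Zp_cast n1).
have fE x : f x = (if x < m then x + m else x - m) :> nat.
  have xn := ltZ x; rewrite /f val_ZpD // val_Zp_nat // (@modn_small m); last lia.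
  case: ifP => xm; first by rewrite modn_small //; lia.
  have -> : x + m = x - m + n by lia.
  by rewrite modnDr modn_small //; lia.
rewrite -/m -(@card_Zp_lt n m) //; last lia.
apply: (@psi_cocktail _ _ f) => [x|x|x y|].
- by apply: ord_inj; have := ltZ x; rewrite !fE; case: ifP; case: ifP; lia.
- by rewrite !inE fE; have := ltZ x; case: ifP; lia.
(* As [k = m - 1] and [n - k = m + 1], the only differences [y - x] outside the connection set are 0
   and [m]. *)
- rewrite /cayley mem_circ_set //; last lia.
  rewrite -[y != f x]/(y != f x :> nat) -[x != y]/(x != y :> nat) fE.
  have -> : (x^-1 * y)%g = (y - x)%R :> 'Z_n by rewrite FinRing.zmodMgE FinRing.zmodVgE GRing.addrC.
  have : (y - x)%R = (if x <= y then y - x else y + n - x) :> nat.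
    have := ltZ x; have := ltZ y; move=> yn xn.
    rewrite val_ZpD // val_ZpN // modnDmr; case: ifP => xy; last by rewrite modn_small; lia.
    have -> : y + (n - x) = y - x + n by lia.
    by rewrite modnDr modn_small //; lia.
  move=> ->; have := ltZ x; have := ltZ y; do 2 case: ifP; lia.
- by rewrite card_Zp_lt //; lia.
Qed.
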